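(* Let $n\ge 1$. A closed $2$-form on the Lie algebra $\mathfrak{sp}(2n,\mathbb{R})$ has generically rank $2n^2$, i.e. its kernel is generically of dimension $n$. Moreover, this kernel is generically a commutative Lie subalgebra of $\mathfrak{sp}(2n,\mathbb{R})$. Explicitly: in the finite-dimensional real vector space of closed $2$-forms on $\mathfrak{sp}(2n,\mathbb{R})$ there is a non-empty Zariski-open subset such that every $\omega$ in it has rank $2n^2$, and $\ker\omega$ is an $n$-dimensional commutative Lie subalgebra.
   Context: $\mathfrak{sp}(2n,\mathbb{R})=\{X\in M(2n\times 2n,\mathbb{R}) : JX=-X^{\mathrm t}J\}$ with $J=\left[\begin{smallmatrix}0&-I\\ I&0\end{smallmatrix}\right]$; it has dimension $2n^2+n$. A $2$-form $\omega\in\bigwedge^2\mathfrak{sp}(2n,\mathbb{R})^*$ is closed if it is closed for the Chevalley–Eilenberg differential, i.e. $\omega([x,y],z)+\omega([y,z],x)+\omega([z,x],y)=0$ for all $x,y,z$; equivalently, the corresponding left-invariant $2$-form on the group $\mathrm{Sp}(2n,\mathbb{R})$ is closed. The kernel of $\omega$ is $\{x : \omega(x,y)=0 \text{ for all } y\}$, and the rank of $\omega$ is $\dim \mathfrak{sp}(2n,\mathbb{R})-\dim\ker\omega$. ''Generically'' is meant in the Zariski sense (hence also on an open dense set in the usual topology) on the vector space of closed $2$-forms. *)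

(* Defs.v *)
From HB Require Import structures.
From mathcomp Require Import all_boot all_order all_algebra.
From mathcomp Require Import mpoly.
From mathcomp Require Import boolp classical_sets reals.

Set Implicit Arguments.
Unset Strict Implicit.
Unset Printing Implicit Defensive.

Import Order.TTheory GRing.Theory Num.Theory.
Local Open Scope ring_scope.

Section Zariski.
Variables (R : fieldType) (vT : vectType R).

(* Evaluation in the coordinates of one fixed basis of vT.  A linear change of
   coordinates maps polynomials to polynomials, so [zariski_open] does not depend on
   the basis. *)
Definition poly_fun (p : {mpoly R[\dim {:vT}]}) (v : vT) : R :=
  p.@[fun i => coord (vbasis {:vT}) i v].

Definition zariski_open (U : set vT) : Prop :=
  exists S : set {mpoly R[\dim {:vT}]},
    U = [set v | exists2 p, S p & poly_fun p v != 0]%classic.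

End Zariski.

Section SymplecticAlgebra.
Variables (R : realType) (n : nat).

Definition symp_J : 'M[R]_(n + n) := block_mx 0 (- 1%:M) 1%:M 0.

Definition sp_defect (X : 'M[R]_(n + n)) : 'M[R]_(n + n) :=
  symp_J *m X + X^T *m symp_J.

Fact sp_defect_is_linear : linear sp_defect.
Proof.
move=> a X Y; rewrite /sp_defect !linearP /= mulmxDl -scalemxAl.
by rewrite scalerDr addrACA.
Qed.
HB.instance Definition _ :=
  GRing.isLinear.Build R _ _ _ sp_defect sp_defect_is_linear.

Definition sp_space : {vspace 'M[R]_(n + n)} := lker (linfun sp_defect).

Lemma sp_spaceP (X : 'M[R]_(n + n)) :
  reflect (symp_J *m X = - X^T *m symp_J) (X \in sp_space).
Proof. by rewrite memv_ker lfunE /= addr_eq0 mulNmx; apply: eqP. Qed.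

Definition sp : vectType R := subvs_of sp_space.

Fact sp_bracket_subproof (x y : sp) :
  vsval x *m vsval y - vsval y *m vsval x \in sp_space.
Proof.
have /sp_spaceP Hx := subvsP x; have /sp_spaceP Hy := subvsP y.
apply/sp_spaceP; rewrite mulmxBr !mulmxA Hx Hy -!mulmxA Hx Hy !mulmxA.
rewrite [(_ - _)^T]linearB /= !trmx_mul opprB mulmxBl.
by rewrite !mulmxN !mulNmx !opprK.
Qed.

Definition sp_bracket (x y : sp) : sp := Subvs (sp_bracket_subproof x y).

Definition is_commutative_Lie_subalgebra (V : {vspace sp}) : Prop :=
  (forall x y, x \in V -> y \in V -> sp_bracket x y \in V) /\
  (forall x y, x \in V -> y \in V -> sp_bracket x y = 0).

Fact sp_bracketPr x : linear (sp_bracket x).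
Proof.
move=> a y z; apply: val_inj; rewrite /= !linearP /= mulmxDl -scalemxAl.
by rewrite opprD scalerBr addrACA.
Qed.

Fact sp_bracketC x y : sp_bracket x y = - sp_bracket y x.
Proof. by apply: val_inj; rewrite /= opprB. Qed.

Fact sp_bracketPl y a x x' :
  sp_bracket (a *: x + x') y = a *: sp_bracket x y + sp_bracket x' y.
Proof.
by rewrite sp_bracketC sp_bracketPr opprD -scalerN -!(sp_bracketC _ y).
Qed.

End SymplecticAlgebra.

Fact scaler_sum3 (R : pzRingType) (V : lmodType R) (a : R) (p q r s t u : V) :
  (a *: p + s) + (a *: q + t) + (a *: r + u)
  = a *: (p + q + r) + (s + t + u).
Proof. by rewrite !scalerDr (addrACA (a *: p)) (addrACA (a *: p + _)). Qed.

Section Forms.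
Variables (R : realType) (n : nat).
Local Notation g := (sp R n).

Definition bilin_form : vectType R := 'Hom(g, 'Hom(g, R^o)).
Implicit Types (w : bilin_form) (x y z : g).

Definition symmetrized w x y : R^o := w x y + w y x.
Definition symmetrized1 w x : 'Hom(g, R^o) := linfun (symmetrized w x).
Definition symmetrized2 w : bilin_form := linfun (symmetrized1 w).

Definition CE_diff w x y z : R^o :=
  w (sp_bracket x y) z + w (sp_bracket y z) x + w (sp_bracket z x) y.
Definition CE_diff1 w x y : 'Hom(g, R^o) := linfun (CE_diff w x y).
Definition CE_diff2 w x : bilin_form := linfun (CE_diff1 w x).
Definition CE_diff3 w : 'Hom(g, bilin_form) := linfun (CE_diff2 w).

(* [linfun] is meaningful on linear maps only; linearity in each argument is
   established below, and [closed_2formsP] gives the membership condition. *)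
Definition closed_2forms : {vspace bilin_form} :=
  (lker (linfun symmetrized2) :&: lker (linfun CE_diff3))%VS.

Fact bilinPl w z a x y : w (a *: x + y) z = a *: w x z + w y z.
Proof. by rewrite linearP add_lfunE scale_lfunE. Qed.

Fact bilinPr w z a x y : w z (a *: x + y) = a *: w z x + w z y.
Proof. exact: linearP. Qed.

Fact bilinPw w w' x y a : (a *: w + w') x y = a *: w x y + w' x y.
Proof. by rewrite !(add_lfunE, scale_lfunE). Qed.

Fact symmetrized_is_linear w x : linear (symmetrized w x).
Proof.
by move=> a y z; rewrite /symmetrized bilinPr bilinPl scalerDr addrACA.
Qed.
HB.instance Definition _ w x :=
  GRing.isLinear.Build R _ _ _ (symmetrized w x) (symmetrized_is_linear w x).

Fact symmetrized1E w x y : symmetrized1 w x y = symmetrized w x y.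
Proof. exact: lfunE. Qed.

Fact symmetrized1_is_linear w : linear (symmetrized1 w).
Proof.
move=> a y z; apply/lfunP => t; rewrite add_lfunE scale_lfunE !symmetrized1E.
by rewrite /symmetrized bilinPr bilinPl scalerDr addrACA.
Qed.
HB.instance Definition _ w :=
  GRing.isLinear.Build R _ _ _ (symmetrized1 w) (symmetrized1_is_linear w).

Fact symmetrized2E w x y : symmetrized2 w x y = symmetrized w x y.
Proof. by rewrite /symmetrized2 lfunE symmetrized1E. Qed.

Fact symmetrized2_is_linear : linear symmetrized2.
Proof.
move=> a w w'; apply/lfunP => x; apply/lfunP => y.
rewrite bilinPw 3!symmetrized2E.
by rewrite /symmetrized !bilinPw scalerDr addrACA.
Qed.
HB.instance Definition _ :=
  GRing.isLinear.Build R _ _ _ symmetrized2 symmetrized2_is_linear.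

Fact CE_diff_is_linear w x y : linear (CE_diff w x y).
Proof.
move=> a z t; rewrite /CE_diff bilinPr sp_bracketPr sp_bracketPl !bilinPl.
exact: scaler_sum3.
Qed.
HB.instance Definition _ w x y :=
  GRing.isLinear.Build R _ _ _ (CE_diff w x y) (CE_diff_is_linear w x y).

Fact CE_diff1E w x y z : CE_diff1 w x y z = CE_diff w x y z.
Proof. exact: lfunE. Qed.

Fact CE_diff1_is_linear w x : linear (CE_diff1 w x).
Proof.
move=> a y z; apply/lfunP => t; rewrite add_lfunE scale_lfunE !CE_diff1E.
rewrite /CE_diff bilinPr sp_bracketPr sp_bracketPl !bilinPl.
exact: scaler_sum3.
Qed.
HB.instance Definition _ w x :=
  GRing.isLinear.Build R _ _ _ (CE_diff1 w x) (CE_diff1_is_linear w x).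

Fact CE_diff2E w x y z : CE_diff2 w x y z = CE_diff w x y z.
Proof. by rewrite /CE_diff2 lfunE CE_diff1E. Qed.

Fact CE_diff2_is_linear w : linear (CE_diff2 w).
Proof.
move=> a x x'; apply/lfunP => y; apply/lfunP => z.
rewrite bilinPw !CE_diff2E.
rewrite /CE_diff bilinPr sp_bracketPr sp_bracketPl !bilinPl.
exact: scaler_sum3.
Qed.
HB.instance Definition _ w :=
  GRing.isLinear.Build R _ _ _ (CE_diff2 w) (CE_diff2_is_linear w).

Fact CE_diff3E w x y z : CE_diff3 w x y z = CE_diff w x y z.
Proof. by rewrite /CE_diff3 lfunE CE_diff2E. Qed.

Fact CE_diff3_is_linear : linear CE_diff3.
Proof.
move=> a w w'; apply/lfunP => x; rewrite add_lfunE scale_lfunE.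
apply/lfunP => y; apply/lfunP => z.
rewrite bilinPw !CE_diff3E.
rewrite /CE_diff !bilinPw; exact: scaler_sum3.
Qed.
HB.instance Definition _ :=
  GRing.isLinear.Build R _ _ _ CE_diff3 CE_diff3_is_linear.

Lemma closed_2formsP w :
  w \in closed_2forms <->
  (forall x, w x x = 0) /\
  (forall x y z,
    w (sp_bracket x y) z + w (sp_bracket y z) x + w (sp_bracket z x) y = 0).
Proof.
rewrite memv_cap !memv_ker !lfunE /=; split.
  case/andP => /eqP Hs /eqP Hd; split => [x|x y z].
    have : symmetrized2 w x x = 0 by rewrite Hs !zero_lfunE.
    rewrite symmetrized2E /symmetrized => /eqP.
    by rewrite -mulr2n mulrn_eq0 /= => /eqP.
  have : CE_diff3 w x y z = 0 by rewrite Hd !zero_lfunE.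
  by rewrite CE_diff3E.
case=> Ha Hd; apply/andP; split; apply/eqP/lfunP => x; apply/lfunP => y.
  rewrite !zero_lfunE symmetrized2E /symmetrized.
  have := Ha (x + y); rewrite (linearD w) add_lfunE (linearD (w x)) (linearD (w y)) /= !Ha.
  by rewrite add0r addr0.
by apply/lfunP => z; rewrite !zero_lfunE CE_diff3E /CE_diff Hd.
Qed.

(* As w x is itself a linear form, [lker w] is {x | w x y = 0 for all y}. *)
Definition form_ker w : {vspace g} := lker w.
Definition form_rank w : nat := (\dim {:g} - \dim (form_ker w))%N.

End Forms.

(* Main.v *)
(* Derivations of sp(2n) being inner, every closed 2-form is
   w x y = tr (a [x, y]) for a unique a in sp(2n), and its kernel is the
   centralizer of a.  The matrix a is written down linearly in w by contracting w
   with the Casimir tensor sum_ij P E_ij (x) P E_ji, where P projects all matrices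
   onto sp(2n); this works because the Casimir element acts on sp(2n) by the nonzero
   scalar 2n+2.  If the vector v = (1,...,1) is cyclic for a, then the centralizer of
   a among all matrices consists of the polynomials in a, which commute; those lying
   in sp(2n) are the odd ones, with basis a, a^3, ..., a^(2n-1).  Cyclicity is the
   nonvanishing of det (v; v a; ...; v a^(2n-1)), a polynomial in w that does not
   vanish at a = diag (1,...,n,-1,...,-n) (Vandermonde). *)
From HB Require Import structures.
Require Import Defs.
From mathcomp Require Import all_boot all_order all_algebra.
From mathcomp Require Import mpoly.
From mathcomp Require Import boolp classical_sets reals.
From mathcomp Require Import ring.
Set Implicit Arguments.
Unset Strict Implicit.
Unset Printing Implicit Defensive.
Import Order.TTheory GRing.Theory Num.Theory.
Local Open Scope ring_scope.

(** * Plain functions whose linearity is a hypothesis, such as partial applications *)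

Lemma linear_fun_sum (R : pzRingType) (U W : lmodType R) (f : U -> W)
    (fl : linear f) I (r : seq I) (P : pred I) (E : I -> U) :
  f (\sum_(i <- r | P i) E i) = \sum_(i <- r | P i) f (E i).
Proof.
pose fL : {linear U -> W} := HB.pack f (GRing.isLinear.Build R U W *:%R f fl).
exact: (linear_sum fL).
Qed.

Lemma linear_funZ (R : pzRingType) (U W : lmodType R) (f : U -> W)
    (fl : linear f) a x :
  f (a *: x) = a *: f x.
Proof.
pose fL : {linear U -> W} := HB.pack f (GRing.isLinear.Build R U W *:%R f fl).
exact: (linearZZ fL).
Qed.

Lemma linear_funB (R : pzRingType) (U W : lmodType R) (f : U -> W)
    (fl : linear f) x y :
  f (x - y) = f x - f y.
Proof.
pose fL : {linear U -> W} := HB.pack f (GRing.isLinear.Build R U W *:%R f fl).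
exact: (linearB fL).
Qed.

(** * Sums over matrix units *)

Section DeltaSums.
Variables (R : comPzRingType) (N : nat).
Implicit Types A B M X Y : 'M[R]_N.

(** Each matrix unit factors as a column times a row, so the middle of the product collapses to a
    scalar. *)
Lemma mul_delta_mx_mul (i j k l : 'I_N) M :
  delta_mx i j *m M *m delta_mx k l = M j k *: (delta_mx i l : 'M[R]_N).
Proof.
rewrite -(mul_delta_mx (0 : 'I_1) i j) -(mul_delta_mx (0 : 'I_1) k l).
rewrite -!mulmxA (mulmxA M) -colE (mulmxA (delta_mx 0 j)) -rowE.
have -> : row j (col k M) = (M j k)%:M.
  by apply/matrixP => a b; rewrite !ord1 !mxE eqxx.
by rewrite mulmxA mul_mx_scalar -scalemxAl mul_delta_mx.
Qed.

Lemma sum_delta_mulC M :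
  \sum_(i < N) \sum_(j < N) delta_mx i j *m M *m delta_mx j i = (\tr M)%:M.
Proof.
rewrite scalar_mx_sum_delta; apply: eq_bigr => i _.
by rewrite /mxtrace scaler_suml; apply: eq_bigr => j _; rewrite mul_delta_mx_mul.
Qed.

Lemma sum_delta_mulT M :
  \sum_(i < N) \sum_(j < N) delta_mx i j *m M *m delta_mx i j = M^T.
Proof.
rewrite [RHS]matrix_sum_delta; apply: eq_bigr => i _; apply: eq_bigr => j _.
by rewrite mul_delta_mx_mul mxE.
Qed.

Variables (V : lmodType R) (F : 'M[R]_N -> 'M[R]_N -> V).
Hypothesis Fl : forall Y, linear (F^~ Y).
Hypothesis Fr : forall X, linear (F X).

Lemma mul_deltaE A (i j : 'I_N) :
  A *m delta_mx i j = \sum_(k < N) A k i *: delta_mx k j.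
Proof.
rewrite -[X in X *m _]mul1mx mx1_sum_delta !mulmx_suml.
by apply: eq_bigr => k _; rewrite mul_delta_mx_mul.
Qed.

Lemma delta_mulE A (i j : 'I_N) :
  delta_mx i j *m A = \sum_(k < N) A j k *: delta_mx i k.
Proof.
rewrite -[LHS]mulmx1 mx1_sum_delta !mulmx_sumr.
by apply: eq_bigr => k _; rewrite mul_delta_mx_mul.
Qed.

(** Both sides expand to triple sums of entries of [A] times [F] at matrix units, and these differ
    only by renaming indices. *)
Lemma sum_delta_movel A :
  \sum_(i < N) \sum_(j < N) F (A *m delta_mx i j) (delta_mx j i) =
  \sum_(i < N) \sum_(j < N) F (delta_mx i j) (delta_mx j i *m A).
Proof.
rewrite exchange_big [RHS]exchange_big; apply: eq_bigr => j _ /=.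
under eq_bigr => i _.
  rewrite mul_deltaE (linear_fun_sum (Fl _)).
  under eq_bigr => k _ do rewrite (linear_funZ (Fl _)).
  over.
rewrite exchange_big; apply: eq_bigr => i _ /=.
rewrite delta_mulE (linear_fun_sum (Fr _)).
by apply: eq_bigr => k _; rewrite (linear_funZ (Fr _)).
Qed.

Lemma sum_delta_mover A :
  \sum_(i < N) \sum_(j < N) F (delta_mx i j *m A) (delta_mx j i) =
  \sum_(i < N) \sum_(j < N) F (delta_mx i j) (A *m delta_mx j i).
Proof.
apply: eq_bigr => i _.
under eq_bigr => j _.
  rewrite delta_mulE (linear_fun_sum (Fl _)).
  under eq_bigr => k _ do rewrite (linear_funZ (Fl _)).
  over.
rewrite exchange_big; apply: eq_bigr => j _ /=.
rewrite mul_deltaE (linear_fun_sum (Fr _)).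
by apply: eq_bigr => k _; rewrite (linear_funZ (Fr _)).
Qed.

(* Invariance of the tensor [\sum_ij E_ij (x) E_ji] under the adjoint action. *)
Lemma sum_delta_ad A :
  \sum_(i < N) \sum_(j < N)
    F (A *m delta_mx i j - delta_mx i j *m A) (delta_mx j i) =
  - \sum_(i < N) \sum_(j < N)
      F (delta_mx i j) (A *m delta_mx j i - delta_mx j i *m A).
Proof.
under eq_bigr => i _ do under eq_bigr => j _ do rewrite (linear_funB (Fl _)).
under [in RHS]eq_bigr => i _ do under eq_bigr => j _ do rewrite (linear_funB (Fr _)).
under eq_bigr => i _ do rewrite sumrB.
under [in RHS]eq_bigr => i _ do rewrite sumrB.
by rewrite !sumrB opprB sum_delta_movel sum_delta_mover.
Qed.

End DeltaSums.

(** * The projection onto sp(2n) and the Casimir element *)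

Section SymplecticProjection.
Variables (R : realType) (n : nat).
Local Notation g := (sp R n).
Local Notation J := (symp_J R n).
Local Notation M := 'M[R]_(n + n).
Local Notation E i j := (delta_mx i j : M).

Lemma mul_symp_J : J *m J = - 1%:M.
Proof.
rewrite /symp_J mulmx_block !mul0mx !mulmx0 !mulNmx !mulmx1 !add0r !addr0 ?oppr0.
by rewrite mul1mx [in RHS](@scalar_mx_block R n n 1) opp_block_mx oppr0.
Qed.

Lemma tr_symp_J : J^T = - J.
Proof.
by rewrite /symp_J tr_block_mx opp_block_mx !trmx0 !linearN /= !trmx1 oppr0 opprK.
Qed.

(** Since [J] has inverse [- J], this is minus the adjoint of [X] for the symplectic form; its fixed
    space is sp(2n). *)
Definition sp_involution (X : M) : M := J *m X^T *m J.

Fact sp_involution_is_linear : linear sp_involution.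
Proof.
move=> a X Y; rewrite /sp_involution linearP /= mulmxDr mulmxDl.
by rewrite -scalemxAr -scalemxAl.
Qed.
HB.instance Definition _ :=
  GRing.isLinear.Build R M M *:%R sp_involution sp_involution_is_linear.

Lemma sp_involutionK : involutive sp_involution.
Proof.
move=> X; rewrite /sp_involution !trmx_mul trmxK tr_symp_J.
rewrite !mulmxA !(mulmxN, mulNmx) opprK mul_symp_J !mulNmx mul1mx.
by rewrite -!mulmxA mul_symp_J mulmxN mulmx1 opprK.
Qed.

Lemma sp_involution1 : sp_involution 1%:M = - 1%:M.
Proof. by rewrite /sp_involution trmx1 mulmx1 mul_symp_J. Qed.

(** Reversal of the product together with the sign means that commutators are preserved. *)
Lemma sp_involutionM X Y :
  sp_involution (X *m Y) = - (sp_involution Y *m sp_involution X).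
Proof.
rewrite /sp_involution trmx_mul !mulmxA -(mulmxA _ J J) mul_symp_J.
by rewrite mulmxN mulmx1 !mulNmx opprK.
Qed.

Lemma mem_sp_involution X : (X \in sp_space R n) = (sp_involution X == X).
Proof.
apply/sp_spaceP/eqP => [H|H].
  rewrite /sp_involution -mulmxA -[X^T *m J]opprK -mulNmx -H.
  by rewrite -mulmxN mulmxA mul_symp_J mulNmx mulmxN opprK mul1mx.
by rewrite -{1}H /sp_involution !mulmxA mul_symp_J !mulNmx mul1mx.
Qed.

Definition sp_proj_mx (X : M) : M := 2^-1 *: (X + sp_involution X).

Fact sp_proj_mx_is_linear : linear sp_proj_mx.
Proof.
move=> a X Y; rewrite /sp_proj_mx scalerA mulrC -scalerA -scalerDr; congr (_ *: _).
by rewrite linearP scalerDr /= addrACA.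
Qed.
HB.instance Definition _ :=
  GRing.isLinear.Build R M M *:%R sp_proj_mx sp_proj_mx_is_linear.

Fact sp_proj_mx_mem X : sp_proj_mx X \in sp_space R n.
Proof.
rewrite mem_sp_involution /sp_proj_mx linearZ linearD /= sp_involutionK.
by rewrite addrC.
Qed.

Definition sp_proj X : g := Subvs (sp_proj_mx_mem X).

Fact sp_proj_is_linear : linear sp_proj.
Proof. by move=> a X Y; apply: val_inj; rewrite /= !linearP. Qed.
HB.instance Definition _ :=
  GRing.isLinear.Build R M g *:%R sp_proj sp_proj_is_linear.

Lemma sp_involution_sp (x : g) : sp_involution (vsval x) = vsval x.
Proof. by apply/eqP; rewrite -mem_sp_involution subvsP. Qed.

Lemma half_add (V : lmodType R) (x : V) : 2^-1 *: (x + x) = x.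
Proof.
by rewrite -mulr2n -scaler_nat scalerA mulVf ?scale1r // pnatr_eq0.
Qed.

Lemma sp_proj_id (x : g) : sp_proj (vsval x) = x.
Proof. by apply: val_inj; rewrite /= /sp_proj_mx sp_involution_sp half_add. Qed.

(** Equivariance of the projection: the involution preserves commutators and fixes [x]. *)
Lemma sp_proj_bracket (x : g) Y :
  sp_proj (vsval x *m Y - Y *m vsval x) = sp_bracket x (sp_proj Y).
Proof.
apply: val_inj; rewrite /= /sp_proj_mx linearB /= !sp_involutionM.
rewrite sp_involution_sp -scalemxAl -scalemxAr -scalerBr; congr (_ *: _).
by rewrite opprK mulmxDl mulmxDr opprD [- _ + vsval x *m _]addrC addrACA.
Qed.

Lemma mxtrace_sp_involution X : \tr (sp_involution X) = - \tr X.
Proof.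
by rewrite mxtrace_mulC mulmxA mul_symp_J mulNmx mul1mx linearN /= mxtrace_tr.
Qed.

(** The involution fixes [y] and preserves the trace form, so [X] and its image have the same trace
    against [y]. *)
Lemma mxtrace_sp_projl X (y : g) :
  \tr (sp_proj_mx X *m vsval y) = \tr (X *m vsval y).
Proof.
rewrite /sp_proj_mx -scalemxAl mulmxDl mxtraceZ mxtraceD.
suff -> : \tr (sp_involution X *m vsval y) = \tr (X *m vsval y).
  exact: (@half_add R^o).
rewrite -[in LHS](sp_involution_sp y) -[LHS]opprK -linearN /= -sp_involutionM.
by rewrite mxtrace_sp_involution opprK mxtrace_mulC.
Qed.

Lemma mxtrace_sp (x : g) : \tr (vsval x) = 0.
Proof.
have /eqP := mxtrace_sp_involution (vsval x); rewrite sp_involution_sp -addr_eq0.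
by rewrite -mulr2n mulrn_eq0 => /eqP.
Qed.

Lemma sp_involution_delta i j : sp_involution (E i j) = J *m E j i *m J.
Proof. by rewrite /sp_involution trmx_delta. Qed.

(** Expanding both projections gives four sums. In two of them the matrix units occur with swapped
    indices and yield a trace; in the other two they are equal and yield a transpose, hence
    [sp_involution Y] up to sign. *)
Lemma sum_sp_proj_mul Y :
  \sum_i \sum_j sp_proj_mx (E i j) *m Y *m sp_proj_mx (E j i) =
  2^-1 *: ((\tr Y)%:M - sp_involution Y).
Proof.
have -> : \sum_i \sum_j sp_proj_mx (E i j) *m Y *m sp_proj_mx (E j i) =
  (2^-1 * 2^-1) *: (\sum_i \sum_j E i j *m Y *m E j i
    + (\sum_i \sum_j E i j *m (Y *m J) *m E i j) *m J
    + J *m (\sum_i \sum_j E j i *m (J *m Y) *m E j i)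
    + J *m (\sum_i \sum_j E j i *m (J *m Y *m J) *m E i j) *m J).
  rewrite !(mulmx_sumr, mulmx_suml) -!big_split scaler_sumr /=.
  apply: eq_bigr => i _.
  rewrite !(mulmx_sumr, mulmx_suml) -!big_split scaler_sumr /=.
  apply: eq_bigr => j _.
  rewrite /sp_proj_mx -!scalemxAl -scalemxAr scalerA; congr (_ *: _).
  rewrite !sp_involution_delta !mulmxDr !mulmxDl !mulmxA.
  by rewrite -!addrA; congr (_ + _); rewrite addrCA.
rewrite sum_delta_mulC sum_delta_mulT.
rewrite [X in _ + J *m X + _]exchange_big sum_delta_mulT /=.
rewrite [X in J *m X *m J]exchange_big sum_delta_mulC /=.
rewrite !trmx_mul tr_symp_J mulmxN !mulNmx mulmxN -/(sp_involution Y).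
rewrite mxtrace_mulC !mulmxA mul_symp_J -/(sp_involution Y) mulNmx mul1mx.
rewrite linearN /= mul_mx_scalar -scalemxAl mul_symp_J scalerN scaleNr opprK.
rewrite scalemx1 -scalerA; congr (_ *: _); rewrite -[RHS](@half_add M).
by congr (_ *: _); rewrite -addrA [- _ + _%:M]addrC.
Qed.

Lemma sum_sp_proj_sqr :
  \sum_i \sum_j sp_proj_mx (E i j) *m sp_proj_mx (E j i) =
  (2^-1 * (n + n + 1)%:R)%:M.
Proof.
have := sum_sp_proj_mul 1%:M; rewrite mxtrace1 sp_involution1 opprK.
rewrite -scale_scalar_mx (natrD _ (n + n)) (raddfD (@scalar_mx R (n + n))) /= => <-.
by apply: eq_bigr => i _; apply: eq_bigr => j _; rewrite mulmx1.
Qed.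

(** The double bracket has four terms. The two with [x] outside contribute (2n+1)/2 each; the two
    with [x] in the middle contribute 1/2 each, because [x] is traceless and fixed by the
    involution. *)
Lemma casimir_sp (x : g) :
  \sum_i \sum_j sp_bracket (sp_proj (E i j)) (sp_bracket (sp_proj (E j i)) x) =
  (n + n + 2)%:R *: x.
Proof.
apply: val_inj; rewrite linearZ [LHS]linear_sum /=.
under eq_bigr => i _ do rewrite linear_sum /=.
transitivity
  ((\sum_i \sum_j sp_proj_mx (E i j) *m sp_proj_mx (E j i)) *m vsval x
   + vsval x *m (\sum_i \sum_j sp_proj_mx (E j i) *m sp_proj_mx (E i j))
   - (\sum_i \sum_j sp_proj_mx (E i j) *m vsval x *m sp_proj_mx (E j i))
   - (\sum_i \sum_j sp_proj_mx (E j i) *m vsval x *m sp_proj_mx (E i j))).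
  rewrite !(mulmx_sumr, mulmx_suml) -big_split -!sumrB /=.
  apply: eq_bigr => i _; rewrite !(mulmx_sumr, mulmx_suml) -big_split -!sumrB.
  apply: eq_bigr => j _ /=; rewrite mulmxBr mulmxBl !mulmxA opprB.
  by rewrite addrACA addrA.
rewrite [X in _ + vsval x *m X]exchange_big /= [X in _ - X = _]exchange_big /=.
rewrite !sum_sp_proj_mul sum_sp_proj_sqr mxtrace_sp sp_involution_sp raddf0 /=.
rewrite add0r scalerN opprK mul_scalar_mx mul_mx_scalar -!scalerDl.
by congr (_ *: _); field.
Qed.

End SymplecticProjection.

(** * Closed 2-forms are exact *)

Section ExactForms.
Variables (R : realType) (n : nat).
Local Notation g := (sp R n).
Local Notation M := 'M[R]_(n + n).
Local Notation p i j := (sp_proj (delta_mx i j : M)).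

Lemma sp_bracketNr (x y : g) : sp_bracket x (- y) = - sp_bracket x y.
Proof. by apply: val_inj; rewrite /= mulmxN mulNmx opprD. Qed.

Lemma sp_jacobi (x y z : g) :
  sp_bracket (sp_bracket x y) z =
  sp_bracket x (sp_bracket y z) - sp_bracket y (sp_bracket x z).
Proof.
apply: val_inj; rewrite /= !(mulmxBl, mulmxBr, mulmxA) !opprB.
rewrite [RHS]addrACA !subrKA [LHS]addrACA [RHS]addrACA.
by congr (_ + _); rewrite addrC.
Qed.

(** A primitive of [w] up to a scalar: for closed [w], its value on a bracket is proportional to
    [w]. *)
Definition casimir_form (w : bilin_form R n) (x : g) : R :=
  \sum_(i < n + n) \sum_(j < n + n) w (p i j) (sp_bracket x (p j i)).

Lemma casimir_form_is_linear w : linear (casimir_form w : g -> R^o).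
Proof.
move=> a x y; rewrite /casimir_form scaler_sumr -big_split; apply: eq_bigr => i _.
rewrite scaler_sumr -big_split; apply: eq_bigr => j _.
by rewrite sp_bracketPl bilinPr.
Qed.

Lemma casimir_formP a w w' x :
  casimir_form (a *: w + w') x = a * casimir_form w x + casimir_form w' x.
Proof.
rewrite /casimir_form mulr_sumr -big_split; apply: eq_bigr => i _.
rewrite mulr_sumr -big_split; apply: eq_bigr => j _.
by rewrite bilinPw.
Qed.

(** This is Cartan's formula L_x w = d (i_x w) for a closed form, with both signs reversed. *)
Lemma closed_2form_cocycle w x y z : w \in closed_2forms R n ->
  w x (sp_bracket y z) = w (sp_bracket x y) z + w y (sp_bracket x z).
Proof.
case/closed_2formsP=> alt /(_ x y z) cl.
have anti u v : w u v = - w v u.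
  apply/eqP; rewrite -addr_eq0; apply/eqP; have := alt (u + v).
  by rewrite (linearD w) add_lfunE !(linearD (w _)) /= !alt add0r addr0.
rewrite (anti x) (anti y) (sp_bracketC x z) (linearN w) opp_lfunE opprK.
by apply: (addIr (w (sp_bracket y z) x)); rewrite addNr addrAC cl.
Qed.

(* Apply the cocycle identity to each [w (p i j) [x, [y, p j i]]]: one resulting sum
   is a Casimir term and, by invariance, the other cancels [A y x]. *)
Lemma closed_2form_exact w x y : w \in closed_2forms R n ->
  casimir_form w (sp_bracket x y) = - (n + n + 2)%:R * w x y.
Proof.
move=> cw.
pose A x y := \sum_(i < n + n) \sum_(j < n + n)
  w (p i j) (sp_bracket x (sp_bracket y (p j i))).
(* Invariance of the tensor moves the bracket with [u] from the first leg to the second, at the cost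
   of a sign. *)
have adA u v : \sum_(i < n + n) \sum_(j < n + n)
    w (sp_bracket u (p i j)) (sp_bracket v (p j i)) = - A v u.
  pose F (X Y : M) : R^o := w (sp_proj X) (sp_bracket v (sp_proj Y)).
  have Fl Y : linear (F^~ Y).
    by move=> a X X'; rewrite /F linearP bilinPl.
  have Fr X : linear (F X).
    by move=> a Y Y'; rewrite /F linearP sp_bracketPr bilinPr.
  have := sum_delta_ad Fl Fr (vsval u).
  rewrite /F /A; under eq_bigr => i _ do under eq_bigr => j _ do
    rewrite sp_proj_bracket.
  move=> ->; congr (- _); apply: eq_bigr => i _; apply: eq_bigr => j _.
  by rewrite sp_proj_bracket.
have -> : casimir_form w (sp_bracket x y) = A x y - A y x.
  rewrite /casimir_form /A -sumrB; apply: eq_bigr => i _.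
  rewrite -sumrB; apply: eq_bigr => j _.
  by rewrite sp_jacobi (linearB (w _)).
have -> : A x y = \sum_(i < n + n) \sum_(j < n + n)
    w (sp_bracket x (p i j)) (- sp_bracket y (p j i)) +
    w x (- \sum_(i < n + n) \sum_(j < n + n)
       sp_bracket (p i j) (sp_bracket (p j i) y)).
  rewrite -sumrN (linear_sum (w x)) -big_split; apply: eq_bigr => i _.
  rewrite -sumrN (linear_sum (w x)) -big_split; apply: eq_bigr => j _ /=.
  rewrite (closed_2form_cocycle _ _ _ cw) [sp_bracket (p i j) x]sp_bracketC.
  rewrite (linearN w) opp_lfunE (linearN (w _)); congr (_ + _).
  by rewrite [sp_bracket y _]sp_bracketC sp_bracketNr.
rewrite casimir_sp (linearN (w x)) (linearZZ (w x)).
under eq_bigr => i _ do under eq_bigr => j _ do rewrite (linearN (w _)).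
under eq_bigr => i _ do rewrite sumrN.
by rewrite sumrN adA opprK addrAC subrr add0r mulNr.
Qed.

(* The factor undoes the Casimir eigenvalue of [casimir_sp], with the sign from
   [closed_2form_exact]. *)
Definition potential_mx (w : bilin_form R n) : M :=
  sp_proj_mx (\matrix_(i, j) (- (n + n + 2)%:R^-1 * casimir_form w (p j i))).

(** Linearity in [w] is what makes the entries of the potential linear polynomials in the
    coordinates of [w]. *)
Lemma potential_mxP a w w' :
  potential_mx (a *: w + w') = a *: potential_mx w + potential_mx w'.
Proof.
rewrite /potential_mx -linearP; congr sp_proj_mx; apply/matrixP => i j.
by rewrite !mxE casimir_formP; ring.
Qed.

Lemma potential_mx_sp w : potential_mx w \in sp_space R n.
Proof. exact: sp_proj_mx_mem. Qed.

(** Against [x] in sp(2n) the outer projection disappears from the trace; what remains is the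
    expansion of [x] in the projected matrix units, which explains the transposed indices in
    [potential_mx]. *)
Lemma mxtrace_potential_mx w (x : g) :
  \tr (potential_mx w *m vsval x) = - (n + n + 2)%:R^-1 * casimir_form w x.
Proof.
rewrite mxtrace_sp_projl -[in RHS](sp_proj_id x).
rewrite {2}[vsval x]matrix_sum_delta exchange_big /= (linear_sum (@sp_proj R n)).
rewrite (linear_fun_sum (casimir_form_is_linear w)) mulr_sumr.
apply: eq_bigr => i _; rewrite mxE.
rewrite (linear_sum (@sp_proj R n)) (linear_fun_sum (casimir_form_is_linear w)).
rewrite mulr_sumr; apply: eq_bigr => j _; rewrite mxE linearZ.
by rewrite (linear_funZ (casimir_form_is_linear w)) /= -mulrA [_ * vsval x _ _]mulrC.
Qed.

Lemma closed_2form_potential w x y : w \in closed_2forms R n ->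
  w x y = \tr (potential_mx w *m vsval (sp_bracket x y)).
Proof.
move=> cw; rewrite mxtrace_potential_mx closed_2form_exact //.
by rewrite !mulNr mulrN opprK mulrA mulVf ?mul1r // pnatr_eq0 addn2.
Qed.


End ExactForms.

(** * The kernel of a closed form as a centralizer, and existence of forms with a given potential *)

Section Centralizer.
Variables (R : realType) (n : nat).
Local Notation g := (sp R n).
Local Notation M := 'M[R]_(n + n).

(** Pairing [z] with the projection of a matrix unit reads off one entry of [z]. *)
Lemma mxtrace_sp_nondeg (z : g) :
  (forall y : g, \tr (vsval z *m vsval y) = 0) -> z = 0.
Proof.
move=> z0; apply: val_inj; apply/matrixP => i j; rewrite mxE.
have := z0 (sp_proj (delta_mx j i)).
rewrite mxtrace_mulC mxtrace_sp_projl -(mul_delta_mx (0 : 'I_1)) -mulmxA.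
rewrite mxtrace_mulC -rowE -colE => <-.
by rewrite /mxtrace big_ord1 !mxE.
Qed.

Lemma mxtrace_sp_bracket (x y z : g) :
  \tr (vsval x *m vsval (sp_bracket y z)) =
  \tr (vsval (sp_bracket x y) *m vsval z).
Proof.
rewrite /= mulmxBr mulmxBl !linearB /= !mulmxA; congr (_ - _).
by rewrite -[in RHS]mulmxA [RHS]mxtrace_mulC.
Qed.

(** The Casimir element kills a central [x], yet multiplies it by 2n+2, which is nonzero. *)
Lemma sp_center_trivial (x : g) : (forall y, sp_bracket y x = 0) -> x = 0.
Proof.
move=> x0; have := casimir_sp x.
have br0 y : sp_bracket y 0 = 0 :> g.
  by apply: val_inj; rewrite /= mulmx0 mul0mx subrr.
rewrite big1 => [/esym/eqP|i _]; last by rewrite big1 // => j _; rewrite x0 br0.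
by rewrite scaler_eq0 pnatr_eq0 addn2 => /eqP.
Qed.

(** With potential a, invariance of the trace form gives w x y = tr ([a, x] y), and this form is
    nondegenerate on sp(2n). *)
Lemma form_ker_centralizer (w : bilin_form R n) (x : g) :
  w \in closed_2forms R n ->
  (x \in form_ker w) =
  (potential_mx w *m vsval x == vsval x *m potential_mx w).
Proof.
move=> cw; pose a : g := Subvs (potential_mx_sp w).
have wE y : w x y = \tr (vsval (sp_bracket a x) *m vsval y).
  by rewrite closed_2form_potential // -mxtrace_sp_bracket.
rewrite memv_ker -[RHS]subr_eq0; apply/eqP/eqP => [w0|ax0].
  rewrite -[LHS]/(vsval (sp_bracket a x)) (_ : sp_bracket a x = 0) //.
  by apply: mxtrace_sp_nondeg => y; rewrite -wE w0 zero_lfunE.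
apply/lfunP => y; rewrite wE /= ax0.
by rewrite mul0mx linear0 zero_lfunE.
Qed.

Section ExactForm.
Variable a : g.

Definition exact_fun (x y : g) : R^o := \tr (vsval a *m vsval (sp_bracket x y)).

Fact exact_fun_is_linear x : linear (exact_fun x).
Proof.
by move=> k y z; rewrite /exact_fun sp_bracketPr linearP linearP.
Qed.
HB.instance Definition _ x :=
  GRing.isLinear.Build R g R^o *:%R (exact_fun x) (exact_fun_is_linear x).

Definition exact_fun1 x : 'Hom(g, R^o) := linfun (exact_fun x).

Fact exact_fun1_is_linear : linear exact_fun1.
Proof.
move=> k y z; apply/lfunP => t; rewrite add_lfunE scale_lfunE !lfunE /=.
by rewrite /exact_fun sp_bracketPl linearP linearP.
Qed.
HB.instance Definition _ :=
  GRing.isLinear.Build R g 'Hom(g, R^o) *:%R exact_fun1 exact_fun1_is_linear.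

Definition exact_form : bilin_form R n := linfun exact_fun1.

Lemma exact_formE x y :
  exact_form x y = \tr (vsval a *m vsval (sp_bracket x y)).
Proof. by rewrite /exact_form lfunE /= lfunE. Qed.

Lemma exact_form_closed : exact_form \in closed_2forms R n.
Proof.
apply/closed_2formsP; split => [x|x y z]; rewrite !exact_formE.
  by rewrite /= subrr mulmx0 linear0.
rewrite -!mxtraceD -!mulmxDr -!(raddfD (@vsval _ _ (sp_space R n))).
rewrite (_ : _ + _ = 0) ?linear0 ?mulmx0 ?linear0 // sp_jacobi.
rewrite [sp_bracket (sp_bracket y z) x]sp_bracketC.
rewrite [sp_bracket (sp_bracket z x) y]sp_bracketC [sp_bracket z x]sp_bracketC.
by rewrite sp_bracketNr opprK [_ - _ - _]addrAC subrr add0r addNr.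
Qed.

(** Uniqueness of the potential: the difference of two potentials is trace-orthogonal to all
    brackets, hence central, hence zero. *)
Lemma potential_exact_form : potential_mx exact_form = vsval a.
Proof.
pose b : g := Subvs (potential_mx_sp exact_form).
suff : b - a = 0 by move/eqP; rewrite subr_eq0 => /eqP <-.
apply: sp_center_trivial => x; rewrite sp_bracketC.
rewrite (mxtrace_sp_nondeg (z := sp_bracket (b - a) x)) ?oppr0 // => y.
rewrite -mxtrace_sp_bracket (raddfB (@vsval _ _ (sp_space R n))) mulmxBl raddfB.
apply/eqP; rewrite subr_eq0; apply/eqP; rewrite -[RHS]exact_formE.
by rewrite (closed_2form_potential _ _ exact_form_closed).
Qed.

End ExactForm.
End Centralizer.

(** * Cyclic vectors and centralizers *)

Section Krylov.
Variables (R : comPzRingType) (N : nat).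
Implicit Types (A X : 'M[R]_N) (v c : 'rV[R]_N).

(** Row vectors are acted on from the right; over a field, invertibility says that [v] is cyclic for
    [A]. *)
Definition krylov_mx v A : 'M[R]_N := \matrix_(k < N) (v *m A ^+ k).

Lemma mul_krylov_mx v A c :
  c *m krylov_mx v A = v *m \sum_(k < N) c 0 k *: A ^+ k.
Proof.
rewrite mulmx_sum_row mulmx_sumr; apply: eq_bigr => k _.
by rewrite rowK -scalemxAr.
Qed.
End Krylov.

(** Allows the matrix to be formed over polynomials first and evaluated afterwards. *)
Lemma map_krylov_mx (R S : comPzRingType) (f : {rmorphism R -> S}) N
    (v : 'rV[R]_N) (A : 'M[R]_N) :
  map_mx f (krylov_mx v A) = krylov_mx (map_mx f v) (map_mx f A).
Proof.
apply/row_matrixP => k; rewrite -map_row !rowK map_mxM; congr (_ *m _).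
by elim: (k : nat) => [|m IH]; rewrite ?map_mx1 // !exprS map_mxM IH.
Qed.

Section CyclicVector.
Variables (F : fieldType) (N : nat) (v : 'rV[F]_N) (A : 'M[F]_N).
Hypothesis cyc : krylov_mx v A \in unitmx.

(** The coefficients [c] are the coordinates of [v *m X] in the basis [v *m A ^+ k]. Then [X] and
    the polynomial agree on [v], and since both commute with [A] they agree on the whole basis. *)
Lemma cyclic_centralizer X : A *m X = X *m A ->
  exists c : 'rV[F]_N, X = \sum_(k < N) c 0 k *: A ^+ k.
Proof.
move=> AX; pose c := v *m X *m invmx (krylov_mx v A); exists c.
set p := \sum_(k < N) _.
have vXp : v *m X = v *m p by rewrite -mul_krylov_mx mulmxKV.
have Ac Y k : A *m Y = Y *m A -> A ^+ k *m Y = Y *m A ^+ k.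
  by move=> AY; elim: k => [|k IH]; rewrite ?mul1mx ?mulmx1 // !exprS
    -!mulmxE -mulmxA IH !mulmxA AY.
have Ap : A *m p = p *m A.
  rewrite mulmx_sumr mulmx_suml; apply: eq_bigr => k _.
  by rewrite -scalemxAr -scalemxAl mulmxE -exprS exprSr.
apply: (can_inj (mulKmx cyc)); apply/row_matrixP => k.
by rewrite !row_mul !rowK -!mulmxA !Ac // !mulmxA vXp.
Qed.

Lemma cyclic_powers_free (c : 'rV[F]_N) :
  \sum_(k < N) c 0 k *: A ^+ k = 0 -> c = 0.
Proof.
move=> c0; apply: (can_inj (mulmxK cyc)).
by rewrite mul_krylov_mx c0 mulmx0 mul0mx.
Qed.

Lemma cyclic_centralizer_comm X Y :
  A *m X = X *m A -> A *m Y = Y *m A -> X *m Y = Y *m X.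
Proof.
move=> /cyclic_centralizer[c ->] /cyclic_centralizer[d ->].
rewrite mulmx_suml mulmx_sumr; apply: eq_bigr => k _.
rewrite mulmx_suml mulmx_sumr; apply: eq_bigr => l _.
by rewrite -!scalemxAl -!scalemxAr !mulmxE -!exprD !scalerA addnC mulrC.
Qed.

End CyclicVector.

Lemma krylov_mx_diag (R : comPzRingType) N (d : 'rV[R]_N) :
  krylov_mx (const_mx 1) (diag_mx d) = Vandermonde N d.
Proof.
apply/row_matrixP => k; rewrite rowK; apply/rowP => j; rewrite !mxE.
have -> : diag_mx d ^+ k = diag_mx (\row_i d 0 i ^+ k).
  elim: (k : nat) => [|m IH].
    by apply/matrixP => a b; rewrite !mxE; case: eqP.
  rewrite exprS IH -mulmxE mulmx_diag; congr diag_mx; apply/rowP => i.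
  by rewrite !mxE exprS.
rewrite (bigD1 j) //= big1 => [|i ij]; rewrite !mxE ?eqxx ?addr0 ?mul1r //.
by rewrite (negbTE ij).
Qed.

(** * Dimensions *)

Lemma sum_ord_even_odd (V : nmodType) (f : nat -> V) n :
  \sum_(k < n + n) f k = \sum_(i < n) (f i.*2 + f i.*2.+1).
Proof.
rewrite addnn; elim: n => [|n IH]; first by rewrite !big_ord0.
by rewrite doubleS !big_ord_recr IH /= addrA.
Qed.

(** Adding the count of pairs with i <= j to that of pairs with j <= i covers every pair once and
    the diagonal twice. *)
Lemma card_ord_pairs_le N :
  (#|[pred p : 'I_N * 'I_N | p.1 <= p.2]|.*2 = N * N + N)%N.
Proof.
pose s (r : rel 'I_N) : nat := (\sum_(i < N) \sum_(j < N) r i j)%N.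
have -> : #|[pred p : 'I_N * 'I_N | (p.1 <= p.2)%N]| = s (fun i j => (i <= j)%N).
  rewrite -sum1_card big_mkcond /s pair_bigA /=.
  by apply: eq_bigr => -[i j] _; rewrite inE /=; case: leqP.
rewrite -addnn {2}/s exchange_big /s -big_split /=.
transitivity (\sum_(i < N) (N + 1))%N; last first.
  by rewrite sum_nat_const card_ord mulnDr muln1.
apply: eq_bigr => i _; rewrite -big_split /=.
transitivity (\sum_(j < N) (1 + (j == i)))%N.
  by apply: eq_bigr => j _; rewrite -val_eqE /=; case: ltngtP.
rewrite big_split /= sum1_card card_ord; congr (_ + _)%N.
by rewrite (bigD1 i) //= eqxx big1 // => j /negbTE ->.
Qed.

Section Dimension.
Variables (R : realType) (n : nat).
Local Notation g := (sp R n).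
Local Notation J := (symp_J R n).
Local Notation M := 'M[R]_(n + n).

(** Multiplication by [J] thus identifies sp(2n) with the symmetric matrices. *)
Lemma mem_sp_sym (X : M) : (X \in sp_space R n) = ((J *m X)^T == J *m X).
Proof.
apply/sp_spaceP/eqP; rewrite trmx_mul tr_symp_J mulmxN mulNmx => ->; exact: erefl.
Qed.

Local Notation T := {p : 'I_(n + n) * 'I_(n + n) | (p.1 <= p.2)%N}.

Definition upper_entries (X : M) : 'rV[R]_#|{: T}| :=
  \row_k (J *m X) (val (enum_val k)).1 (val (enum_val k)).2.

Fact upper_entries_is_linear : linear upper_entries.
Proof.
move=> a X Y; rewrite {1}/upper_entries mulmxDr -scalemxAr.
by apply/rowP => k; rewrite mxE [in LHS]mxE [in LHS]mxE !mxE.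
Qed.
HB.instance Definition _ :=
  GRing.isLinear.Build R M 'rV[R]_#|{: T}| *:%R upper_entries upper_entries_is_linear.

(** The entries of the symmetric matrix [J *m X] on and above the diagonal are coordinates on
    sp(2n), and there are n(2n+1) of them. *)
Lemma dim_sp : \dim {: g} = (2 * n ^ 2 + n)%N.
Proof.
have -> : \dim {: g} = \dim (sp_space R n) by rewrite dimvf.
pose f : 'Hom(M, 'rV[R]_#|{: T}|) := linfun upper_entries.
have f0 : (sp_space R n :&: lker f)%VS = 0%VS.
  apply/eqP; rewrite -subv0; apply/subvP => X; rewrite memv_cap mem_sp_sym.
  rewrite memv_ker lfunE memv0 => /andP[/eqP JX /eqP X0].
  have JX0 (i j : 'I_(n + n)) : (i <= j)%N -> (J *m X) i j = 0.
    move=> ij; have /rowP/(_ (enum_rank (exist _ (i, j) ij : T))) := X0.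
    by rewrite /= /upper_entries mxE enum_rankK /= => ->; rewrite mxE.
  suff : J *m X = 0.
    move/(congr1 (mulmx J)); rewrite mulmxA mul_symp_J mulmx0 mulNmx mul1mx.
    by move/eqP; rewrite oppr_eq0.
  apply/matrixP => i j; rewrite [RHS]mxE; have [/JX0 //|/ltnW/JX0] := leqP i j.
  by rewrite -{1}JX mxE.
rewrite -(limg_dim_eq f0).
have -> : (f @: sp_space R n)%VS = fullv.
  apply/eqP; rewrite eqEsubv subvf; apply/subvP => r _.
  have leqm (i j : 'I_(n + n)) : ((if (i <= j)%N then (i, j) else (j, i)).1
      <= (if (i <= j)%N then (i, j) else (j, i)).2)%N.
    by case: (leqP i j) => //= /ltnW.
  pose le_pair (p : 'I_(n + n) * 'I_(n + n)) := (p.1 <= p.2)%N.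
  (* The symmetric matrix with upper entries [r], obtained by sorting each index pair; its preimage
     is [- (J *m S)]. *)
  pose S : M := \matrix_(i, j)
    r 0 (enum_rank (exist (fun p => is_true (le_pair p)) _ (leqm i j) : T)).
  have JS : J *m - (J *m S) = S.
    by rewrite mulmxN mulmxA mul_symp_J mulNmx opprK mul1mx.
  have St : S^T = S.
    apply/matrixP => i j; rewrite !mxE; congr (r 0 (enum_rank _)); apply: val_inj => /=.
    by case: ltngtP => // /val_inj ->.
  apply/memv_imgP; exists (- (J *m S)); first by rewrite mem_sp_sym JS St.
  rewrite lfunE /=; apply/rowP => k; rewrite /upper_entries JS !mxE; congr (r 0 _).
  rewrite -[LHS]enum_valK; congr enum_rank; apply: val_inj => /=.
  by case: (enum_val k) => -[i j] /= ->.
rewrite dimvf /dim /= mul1n card_sig; apply: double_inj; rewrite card_ord_pairs_le.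
by rewrite -!muln2; ring.
Qed.

(** * The centralizer in sp(2n) of an element with a cyclic vector *)

Section CyclicElement.
Variables (a : g) (v : 'rV[R]_(n + n)).
Hypothesis cyc : krylov_mx v (vsval a) \in unitmx.

(** The sign separates parities: odd powers of [a] are fixed, hence in sp(2n), and even powers are
    negated. *)
Lemma sp_involution_exp k :
  sp_involution (vsval a ^+ k) = (-1) ^+ k.+1 *: vsval a ^+ k.
Proof.
elim: k => [|k IH]; first by rewrite expr0 expr1 sp_involution1 scaleN1r.
rewrite exprS sp_involutionM sp_involution_sp IH -scalemxAl mulmxE -exprSr.
by rewrite -exprS [in RHS](exprS _ k.+1) mulN1r scaleNr.
Qed.

Lemma sp_proj_exp_odd k : odd k -> sp_proj_mx (vsval a ^+ k) = vsval a ^+ k.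
Proof.
move=> ok; rewrite /sp_proj_mx sp_involution_exp -signr_odd /= ok /=.
by rewrite scale1r half_add.
Qed.

Lemma sp_proj_exp_even k : ~~ odd k -> sp_proj (vsval a ^+ k) = 0.
Proof.
move=> ek; apply: val_inj; rewrite /= /sp_proj_mx sp_involution_exp -signr_odd /= ek.
by rewrite scaleN1r subrr scaler0.
Qed.

(** The projection leaves these odd powers unchanged; it serves to give them the type [g]. *)
Definition odd_powers : n.-tuple g := [tuple sp_proj (vsval a ^+ i.*2.+1) | i < n].

Lemma odd_powers_free : free odd_powers.
Proof.
apply/freeP => c; under eq_bigr => i _ do rewrite (nth_mktuple _ _ i).
(* [h] extends [c] by zero to all naturals, and [d] places it at the odd exponents, so that freeness
   of all powers below 2n applies. *)
move=> c0; pose h m := oapp c 0 (insub m).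
have hE (i : 'I_n) : h i = c i by rewrite /h valK.
pose d : 'rV[R]_(n + n) := \row_k (if odd k then h k./2 else 0).
have /(cyclic_powers_free cyc) d0 : \sum_k d 0 k *: vsval a ^+ k = 0.
  transitivity (vsval (\sum_(i < n) c i *: sp_proj (vsval a ^+ i.*2.+1))); last first.
    by rewrite c0.
  under eq_bigr => k _ do rewrite mxE.
  rewrite (sum_ord_even_odd (fun k => (if odd k then h k./2 else 0) *: vsval a ^+ k)).
  rewrite linear_sum; apply: eq_bigr => i _.
  rewrite oddS odd_double scale0r add0r /= uphalf_double hE; congr (_ *: _).
  by rewrite sp_proj_exp_odd //= odd_double.
move=> i; have lt : (i.*2.+1 < n + n)%N by rewrite addnn ltn_Sdouble.
have /rowP/(_ (Ordinal lt)) := d0.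
by rewrite !mxE /= odd_double /= uphalf_double hE.
Qed.

(** An element of the centralizer is a polynomial in [a] and equals its own projection, which kills
    the even powers. *)
Lemma span_odd_powers (x : g) :
  (x \in <<odd_powers>>%VS) = (vsval a *m vsval x == vsval x *m vsval a).
Proof.
apply/idP/eqP => [|ax].
  move/coord_span ->; rewrite linear_sum mulmx_sumr mulmx_suml.
  apply: eq_bigr => i _; rewrite -[GRing.Linear.sort _]/(@vsval _ _ (sp_space R n)).
  have -> : vsval (coord odd_powers i x *: odd_powers`_i)
      = coord odd_powers i x *: vsval a ^+ i.*2.+1.
    rewrite (nth_mktuple _ _ i) linearZ; congr (_ *: _).
    by apply: sp_proj_exp_odd; rewrite /= odd_double.
  by rewrite -scalemxAr -scalemxAl mulmxE -exprS -exprSr.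
have [c xE] := cyclic_centralizer cyc ax.
rewrite -(sp_proj_id x) xE (linear_sum (@sp_proj R n)); apply: memv_suml => k _.
rewrite linearZ; apply: memvZ => /=.
have [ok|ek] := boolP (odd k); last by rewrite sp_proj_exp_even ?mem0v.
apply: memv_span.
have lt : (k./2 < n)%N by rewrite ltn_half_double -addnn.
apply/mapP; exists (Ordinal lt); first by rewrite mem_enum.
by congr (sp_proj (_ ^+ _)); rewrite -[LHS]odd_double_half ok.
Qed.

End CyclicElement.
End Dimension.

(** * Genericity *)

Section CyclicityPolynomial.
Variables (R : realType) (n : nat).
Local Notation Z := (subvs_of (closed_2forms R n)).
Local Notation d := (\dim {: Z}).

(** The potential of the closed form with indeterminate coordinates. *)
Definition generic_potential_mx : 'M[{mpoly R[d]}]_(n + n) :=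
  \matrix_(i, j) \sum_(k < d)
    (potential_mx (vsval (vbasis {: Z})`_k) i j)%:MP_[d] * 'X_k.

Definition cyclicity_poly : {mpoly R[d]} :=
  \det (krylov_mx (const_mx 1) generic_potential_mx).

Lemma cyclicity_polyE (w : Z) :
  poly_fun cyclicity_poly w =
  \det (krylov_mx (const_mx 1) (potential_mx (vsval w))).
Proof.
rewrite /poly_fun /cyclicity_poly -det_map_mx map_krylov_mx map_const_mx rmorph1.
congr (\det (krylov_mx _ _)).
pose pot (u : Z) : 'M[R]_(n + n) := potential_mx (vsval u).
have potl : linear pot by move=> a u u'; rewrite /pot linearP potential_mxP.
rewrite -/(pot w) {2}(coord_vbasis (memvf w)) (linear_fun_sum potl).
apply/matrixP => i j; rewrite !mxE raddf_sum summxE; apply: eq_bigr => k _ /=.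
by rewrite (linear_funZ potl) [RHS]mxE rmorphM /= mevalC mevalXU mulrC.
Qed.

End CyclicityPolynomial.

Section CyclicWitness.
Variables (R : realType) (n : nat).

(** Numbering from 1 rather than 0 keeps the two halves disjoint, so all eigenvalues are
    distinct. *)
Definition witness_diag : 'rV[R]_(n + n) :=
  row_mx (\row_i i.+1%:R) (- \row_i i.+1%:R).

Lemma witness_sp : diag_mx witness_diag \in sp_space R n.
Proof.
rewrite mem_sp_sym /witness_diag diag_mx_row /symp_J mulmx_block.
rewrite !mul0mx !mulmx0 !mulNmx !mul1mx !add0r !addr0 tr_block_mx !trmx0.
by rewrite !linearN /= !tr_diag_mx opprK.
Qed.

Lemma witness_cyclic : \det (krylov_mx (const_mx 1) (diag_mx witness_diag)) != 0.
Proof.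
have inj i j : witness_diag 0 i = witness_diag 0 j -> i = j.
  have pos (k l : nat) : k.+1%:R != - l.+1%:R :> R.
    by rewrite -addr_eq0 -natrD pnatr_eq0.
  rewrite -(splitK i) -(splitK j); case: (split i) => i'; case: (split j) => j' /=;
    rewrite /witness_diag ?(row_mxEl, row_mxEr) !mxE.
  - by move/eqP; rewrite eqr_nat eqSS => /eqP/val_inj ->.
  - by move/eqP; rewrite (negbTE (pos _ _)).
  - by move/esym/eqP; rewrite (negbTE (pos _ _)).
  - by move/oppr_inj/eqP; rewrite eqr_nat eqSS => /eqP/val_inj ->.
rewrite krylov_mx_diag det_Vandermonde; apply/prodf_neq0 => i _.
apply/prodf_neq0 => j ij; rewrite subr_eq0; apply: contraTneq ij => /inj ->.
by rewrite ltnn.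
Qed.

End CyclicWitness.

Theorem theorem3p2 (R : realType) (n : nat) (hn : (1 <= n)%N) :
  exists U : set (subvs_of (closed_2forms R n)),
    [/\ zariski_open U,
        (U !=set0)%classic &
        forall w : subvs_of (closed_2forms R n), U w ->
          [/\ form_rank (vsval w) = (2 * n ^ 2)%N,
              \dim (form_ker (vsval w)) = n &
              is_commutative_Lie_subalgebra (form_ker (vsval w))]].
Proof.
(* The principal open set of closed forms whose potential has (1,...,1) as a cyclic vector. *)
exists [set w | poly_fun (cyclicity_poly R n) w != 0]%classic; split.
- exists [set cyclicity_poly R n]%classic; apply/seteqP.
  by split => w /= => [w0|[p -> //]]; exists (cyclicity_poly R n).
(* The closed form with the diagonal witness as its potential. *)
- exists (Subvs (exact_form_closed (Subvs (witness_sp R n)))) => /=.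
  by rewrite cyclicity_polyE /= potential_exact_form witness_cyclic.
move=> w /=; rewrite cyclicity_polyE -unitfE -[_ \is a _]/(krylov_mx _ _ \in unitmx).
pose a : sp R n := Subvs (potential_mx_sp (vsval w)).
move=> cyc; have kerE x : (x \in form_ker (vsval w)) =
    (vsval a *m vsval x == vsval x *m vsval a).
  exact: form_ker_centralizer (subvsP w).
have dim_ker : \dim (form_ker (vsval w)) = n.
  have -> : form_ker (vsval w) = <<odd_powers a>>%VS.
    by apply/vspaceP => x; rewrite kerE (span_odd_powers (a := a) cyc).
  have /eqP -> := odd_powers_free (a := a) cyc; exact: size_tuple.
(* Kernel elements commute with the cyclic matrix [a], hence are polynomials in it and commute with
   each other. *)
have comm x y : x \in form_ker (vsval w) -> y \in form_ker (vsval w) ->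
    sp_bracket x y = 0.
  rewrite !kerE => /eqP ax /eqP ay; apply: val_inj => /=.
  by rewrite (cyclic_centralizer_comm cyc ax ay) subrr.
split=> //; first by rewrite /form_rank dim_ker dim_sp addnK.
by split=> // x y kx ky; rewrite comm ?mem0v.
Qed.
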